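(* Consider the convex problem with data $f_i,\mathcal X_i,A_i,\mathbf b,g_{ji}$ described in the context, and assume: (i) (Slater) there exist $\bar{\mathbf x}_i\in \mathrm{relint}(\mathcal X_i)$, $i=1,\dots,N$, with $\sum_{i=1}^N A_i\bar{\mathbf x}_i=\mathbf b$ and $\sum_{i=1}^N g_{ji}(\bar{\mathbf x}_i)<0$ for all $j=1,\dots,M$; (ii) (Lipschitz continuity) for all $i,j$, $g_{ji}$ is Lipschitz continuous on $\mathcal X_i$ with modulus $L_{ji}$, i.e. $|g_{ji}(\mathbf x)-g_{ji}(\mathbf y)|\le L_{ji}\|\mathbf x-\mathbf y\|_2$ for all $\mathbf x,\mathbf y\in\mathcal X_i$; (iii) a saddle point of the Lagrangian $\mathcal L$ exists. Given a scalar $0<\epsilon<1$, choose a step size $\rho$ satisfying $$0<\rho\le\min\left\{\frac{1-\epsilon}{A_{max}+M L_{max}},\ \frac{1-\epsilon}{N A_{max}},\ \frac{1-\epsilon}{N L_{max}}\right\},$$ where $A_{max}=\max_{1\le i\le N}\|A_i\|_2$ (spectral norms) and $L_{max}=\max_{1\le j\le M}\max_{1\le i\le N}L_{ji}$. Let $\{(\mathbf x_1^k,\dots,\mathbf x_N^k,\bm\lambda^k,\bm\mu^k)\}_{k\ge0}$ be the sequence generated by the $N$-PCPM algorithm with step size $\rho$ from an arbitrary starting point $(\mathbf x_1^0,\dots,\mathbf x_N^0,\bm\lambda^0,\bm\mu^0)$. Then the sequence converges to a saddle point $(\mathbf x_1^*,\dots,\mathbf x_N^*,\bm\lambda^*,\bm\mu^*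 )$ of the problem.
   Context: Problem: minimize $\sum_{i=1}^N f_i(\mathbf x_i)$ over $\mathbf x_i\in\mathcal X_i$, $i=1,\dots,N$, subject to $\sum_{i=1}^N A_i\mathbf x_i=\mathbf b$ and $\sum_{i=1}^N g_{ji}(\mathbf x_i)\le 0$ for $j=1,\dots,M$. Here $\mathcal X_i\subset\mathbb R^{n_i}$ is closed and convex, $f_i:\mathbb R^{n_i}\to\mathbb R$ and $g_{ji}:\mathbb R^{n_i}\to\mathbb R$ are continuous and convex, $A_i\in\mathbb R^{m\times n_i}$, $\mathbf b\in\mathbb R^m$. Lagrangian: $\mathcal L(\mathbf x_1,\dots,\mathbf x_N,\bm\lambda,\bm\mu)=\sum_{i} f_i(\mathbf x_i)+\bm\lambda^T(\sum_i A_i\mathbf x_i-\mathbf b)+\sum_{j}\mu_j\sum_i g_{ji}(\mathbf x_i)$. A saddle point (of the problem, equivalently of $\mathcal L$) is a point $(\mathbf x_1^*,\dots,\mathbf x_N^*,\bm\lambda^*,\bm\mu^* )\in\prod_i\mathcal X_i\times\mathbb R^m\times\mathbb R_+^M$ such that $\mathcal L(\mathbf x^*,\bm\lambda,\bm\mu)\le\mathcal L(\mathbf x^*,\bm\lambda^*,\bm\mu^* )\le\mathcal L(\mathbf x,\bm\lambda^*,\bm\mu^* )$ for all $\mathbf x=(\mathbf x_1,\dots,\mathbf x_N)\in\prod_i\mathcal X_i$, $\bm\lambda\in\mathbb R^m$, $\bm\mu\in\mathbb R_+^M$. $N$-PCPM algorithm with step size $\rho>0$: given $(\mathbf x_1^k,\dots,\mathbf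 x_N^k,\bm\lambda^k,\bm\mu^k)$, compute for $k=0,1,2,\dots$ (with $\Pi_{\mathbb R_+}$ the projection onto $[0,\infty)$) (predictor) $\bm\gamma^{k+1}=\bm\lambda^k+\rho(\sum_i A_i\mathbf x_i^k-\mathbf b)$, $\nu_j^{k+1}=\Pi_{\mathbb R_+}[\mu_j^k+\rho\sum_i g_{ji}(\mathbf x_i^k)]$, $j=1,\dots,M$; (primal) $\mathbf x_i^{k+1}=\arg\min_{\mathbf x_i\in\mathcal X_i} f_i(\mathbf x_i)+(\bm\gamma^{k+1})^TA_i\mathbf x_i+\sum_{j=1}^M\nu_j^{k+1}g_{ji}(\mathbf x_i)+\frac1{2\rho}\|\mathbf x_i-\mathbf x_i^k\|_2^2$, $i=1,\dots,N$; (corrector) $\bm\lambda^{k+1}=\bm\lambda^k+\rho(\sum_i A_i\mathbf x_i^{k+1}-\mathbf b)$, $\mu_j^{k+1}=\Pi_{\mathbb R_+}[\mu_j^k+\rho\sum_i g_{ji}(\mathbf x_i^{k+1})]$, $j=1,\dots,M$. *)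

(* Defs.v *)
From HB Require Import structures.
From mathcomp Require Import all_boot all_order all_algebra.
From mathcomp Require Import all_classical all_reals all_analysis.

Set Implicit Arguments.
Unset Strict Implicit.
Unset Printing Implicit Defensive.

Import Order.TTheory GRing.Theory Num.Theory.
Import numFieldNormedType.Exports.

Local Open Scope classical_set_scope.
Local Open Scope ring_scope.

Section Euclidean.
Context {R : realType}.

Definition dotp n (u v : 'cV[R]_n) : R := \sum_(i < n) u i 0 * v i 0.

(* The library norm on matrices is the sup norm, hence this definition; both
   induce the same topology, so the library topology is kept throughout. *)
Definition norm2 n (u : 'cV[R]_n) : R := Num.sqrt (dotp u u).

(* The operator norm induced by [norm2]. *)
Definition spectral_norm m n (A : 'M[R]_(m, n)) : R :=
  sup [set norm2 (A *m x) | x in [set x : 'cV[R]_n | norm2 x <= 1]].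

Definition aff_hull n (C : set 'cV[R]_n) : set 'cV[R]_n :=
  [set y | exists k (w : 'I_k -> R) (p : 'I_k -> 'cV[R]_n),
     [/\ forall i, C (p i), \sum_i w i = 1 & y = \sum_i w i *: p i]].

Definition relint n (C : set 'cV[R]_n) : set 'cV[R]_n :=
  [set x | C x /\ \forall y \near x, aff_hull C y -> C y].

Definition is_argmin (T : Type) (C : set T) (F : T -> R) (x : T) : Prop :=
  C x /\ forall y, C y -> F x <= F y.

(* [p] is the projection of the real number [s] onto [0, +oo[. *)
Definition is_proj_nneg (s p : R) : Prop :=
  is_argmin [set t : R | 0 <= t] (fun t => `|t - s|) p.

End Euclidean.

Unset Implicit Arguments.

Section Problem.
Context {R : realType} {N M m : nat} {n : 'I_N -> nat}.
Variables (X : forall i, set 'cV[R]_(n i)) (f : forall i, 'cV[R]_(n i) -> R).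
Variables (A : forall i, 'M[R]_(m, n i)) (b : 'cV[R]_m).
Variable g : 'I_M -> forall i, 'cV[R]_(n i) -> R.

Definition lagrangian (x : forall i, 'cV[R]_(n i))
    (lam : 'cV[R]_m) (mu : 'cV[R]_M) : R :=
  \sum_(i < N) f i (x i) + dotp lam (\sum_(i < N) A i *m x i - b)
  + \sum_(j < M) mu j 0 * \sum_(i < N) g j i (x i).

Definition saddle_point (xs : forall i, 'cV[R]_(n i))
    (lams : 'cV[R]_m) (mus : 'cV[R]_M) : Prop :=
  [/\ forall i, X i (xs i),
      forall j, 0 <= mus j 0,
      forall (lam : 'cV[R]_m) (mu : 'cV[R]_M), (forall j, 0 <= mu j 0) ->
        lagrangian xs lam mu <= lagrangian xs lams mus
    & forall x : forall i, 'cV[R]_(n i), (forall i, X i (x i)) ->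
        lagrangian xs lams mus <= lagrangian x lams mus].

(* One iteration, from (x, lam, mu) to (x', lam', mu'): predictor (gam, nu),
   proximal primal step, corrector. *)
Definition pcpm_step (rho : R)
    (x : forall i, 'cV[R]_(n i)) (lam : 'cV[R]_m) (mu : 'cV[R]_M)
    (x' : forall i, 'cV[R]_(n i)) (lam' : 'cV[R]_m) (mu' : 'cV[R]_M) : Prop :=
  exists (gam : 'cV[R]_m) (nu : 'cV[R]_M),
  [/\ gam = lam + rho *: (\sum_(i < N) A i *m x i - b),
      forall j, is_proj_nneg (mu j 0 + rho * \sum_(i < N) g j i (x i)) (nu j 0),
      forall i, is_argmin (X i)
        (fun y => f i y + dotp gam (A i *m y) + \sum_(j < M) nu j 0 * g j i y
                  + (2 * rho)^-1 * norm2 (y - x i) ^+ 2)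
        (x' i),
      lam' = lam + rho *: (\sum_(i < N) A i *m x' i - b)
    & forall j,
        is_proj_nneg (mu j 0 + rho * \sum_(i < N) g j i (x' i)) (mu' j 0)].

End Problem.

(* Maxima of nonnegative quantities, so that 0 is a neutral initial value. *)
Definition Amax {R : realType} {N m : nat} {n : 'I_N -> nat}
    (A : forall i, 'M[R]_(m, n i)) : R :=
  \big[Num.max/0]_(i < N) spectral_norm (A i).

Definition Lmax {R : realType} {N M : nat} (L : 'I_M -> 'I_N -> R) : R :=
  \big[Num.max/0]_(j < M) \big[Num.max/0]_(i < N) L j i.

(* Computed in the extended reals: a fraction with denominator 0 is +oo there
   (the numerator is positive), i.e. it imposes no restriction on the step. *)
Definition step_bound {R : realType} (N M : nat) (eps Am Lm : R) : \bar R :=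
  mine ((1 - eps)%:E / (Am + M%:R * Lm)%:E)%E
    (mine ((1 - eps)%:E / (N%:R * Am)%:E)%E
          ((1 - eps)%:E / (N%:R * Lm)%:E)%E).

(* Main.v *)
Require Import Defs.
From HB Require Import structures.
From mathcomp Require Import all_boot all_order all_algebra.
From mathcomp Require Import all_classical all_reals all_analysis.
From mathcomp Require Import ring lra.

Set Implicit Arguments.
Unset Strict Implicit.
Unset Printing Implicit Defensive.

Import Order.TTheory GRing.Theory Num.Theory.
Import numFieldNormedType.Exports.

Local Open Scope classical_set_scope.
Local Open Scope ring_scope.

(** The state [(x, lam, mu)] moves closer to every saddle point at each
    iteration, and this forces convergence.

    Write [c x] for the residual of the equalities and [G x] for the vector of
    the constraint values.  The dual updates form an extragradient scheme: the
    predictor projects along the residual at the old primal point, the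
    corrector along the residual at the new one.  Testing the predictor
    inequality at the corrected multiplier and the corrector inequality at a
    saddle multiplier bounds the dual part of the squared distance to the
    saddle point ([extragradient]).  The proximal primal step gives the
    analogous bound for the primal part, since convexity turns minimality into
    a variational inequality ([prox_variational]).  When both are added, the
    Lagrangian terms have a sign by the saddle inequalities, and what remains
    are the couplings [<lam' - gam, c x' - c x>] and [<mu' - nu, G x' - G x>].
    Young's inequality bounds them by squares of increments with factors
    [rho (Amax + M Lmax)], [rho N Amax] and [rho N Lmax]; the step-size bound
    keeps all three below [1 - eps].  Hence the squared distance drops by at
    least [eps] times the squared increments ([pcpm_fejer]).

    Consequently the increments tend to [0] and the iterates are bounded, so
    they converge along an ultrafilter refining the neighbourhoods of infinity;
    this replaces the extraction of a subsequence.  As the old point, the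
    predictor and the new point have the same limit, the variational
    inequalities pass to the limit as the two saddle inequalities
    ([saddle_point_of_limit]).  The distance to this particular saddle point is
    nonincreasing and tends to [0] along the ultrafilter, hence tends to [0]
    along the whole sequence. *)

(** * Euclidean inner product and spectral norm *)

Section EuclideanNorm.
Context {R : realType}.

Lemma dotpDr n (u v w : 'cV[R]_n) : dotp u (v + w) = dotp u v + dotp u w.
Proof.
by rewrite /dotp -big_split; apply: eq_bigr => i _; rewrite mxE mulrDr.
Qed.

Lemma dotpZr n c (u v : 'cV[R]_n) : dotp u (c *: v) = c * dotp u v.
Proof. by rewrite /dotp mulr_sumr; apply: eq_bigr => i _; rewrite mxE; ring. Qed.

Lemma dotp0r n (u : 'cV[R]_n) : dotp u 0 = 0.
Proof. by apply: big1 => i _; rewrite mxE mulr0. Qed.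

Lemma dotpBr n (u v w : 'cV[R]_n) : dotp u (v - w) = dotp u v - dotp u w.
Proof. by rewrite dotpDr -scaleN1r dotpZr; ring. Qed.

Lemma dotp_sumr n (I : finType) (u : 'cV[R]_n) (v : I -> 'cV[R]_n) :
  dotp u (\sum_i v i) = \sum_i dotp u (v i).
Proof.
rewrite /dotp exchange_big; apply: eq_bigr => i _.
by rewrite summxE mulr_sumr.
Qed.

Lemma dotp_ge0 n (u : 'cV[R]_n) : 0 <= dotp u u.
Proof. by apply: sumr_ge0 => i _; rewrite -expr2 sqr_ge0. Qed.

Lemma norm2_ge0 n (u : 'cV[R]_n) : 0 <= norm2 u.
Proof. exact: sqrtr_ge0. Qed.

Lemma sqr_norm2 n (u : 'cV[R]_n) : norm2 u ^+ 2 = dotp u u.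
Proof. by rewrite sqr_sqrtr ?dotp_ge0. Qed.

Lemma norm2Z n c (u : 'cV[R]_n) : norm2 (c *: u) = `|c| * norm2 u.
Proof.
rewrite /norm2 -sqrtr_sqr -sqrtrM ?sqr_ge0//; congr Num.sqrt.
by rewrite /dotp mulr_sumr; apply: eq_bigr => i _; rewrite mxE; ring.
Qed.

Lemma sqr_coord_le n (u : 'cV[R]_n) i : u i 0 ^+ 2 <= dotp u u.
Proof.
rewrite /dotp (bigD1 i)//= -expr2 lerDl.
by apply: sumr_ge0 => j _; rewrite -expr2 sqr_ge0.
Qed.

Lemma norm2_eq0 n (u : 'cV[R]_n) : norm2 u = 0 -> u = 0.
Proof.
move=> u0; apply/matrixP => i j; rewrite ord1 mxE.
apply/eqP; rewrite -sqrf_eq0 eq_le sqr_ge0 andbT.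
by rewrite (le_trans (sqr_coord_le u i))// -sqr_norm2 u0 expr0n.
Qed.

Lemma norm20 n : norm2 (0 : 'cV[R]_n) = 0.
Proof. by rewrite -(scale0r (0 : 'cV[R]_n)) norm2Z normr0 mul0r. Qed.

(** Cauchy-Schwarz, from [0 <= |s v - t u|^2] with [s = |u|] and [t = |v|]. *)
Lemma dotp_le_norm2 n (u v : 'cV[R]_n) : dotp u v <= norm2 u * norm2 v.
Proof.
have [u0|u0] := eqVneq (norm2 u) 0.
  rewrite u0 (norm2_eq0 u0) mul0r /dotp big1// => i _.
  by rewrite mxE mul0r.
have [v0|v0] := eqVneq (norm2 v) 0.
  rewrite v0 (norm2_eq0 v0) mulr0 /dotp big1// => i _.
  by rewrite mxE mulr0.
have up : 0 < norm2 u by rewrite lt_neqAle eq_sym u0 norm2_ge0.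
have vp : 0 < norm2 v by rewrite lt_neqAle eq_sym v0 norm2_ge0.
have := dotp_ge0 (norm2 u *: v - norm2 v *: u).
have -> : dotp (norm2 u *: v - norm2 v *: u) (norm2 u *: v - norm2 v *: u)
  = norm2 u ^+ 2 * dotp v v - 2 * (norm2 u * norm2 v) * dotp u v
    + norm2 v ^+ 2 * dotp u u.
  rewrite /dotp !mulr_sumr -sumrB -big_split; apply: eq_bigr => i _ /=.
  by rewrite !mxE; ring.
rewrite -!sqr_norm2.
have -> : norm2 u ^+ 2 * norm2 v ^+ 2 - 2 * (norm2 u * norm2 v) * dotp u v
    + norm2 v ^+ 2 * norm2 u ^+ 2
  = 2 * (norm2 u * norm2 v) * (norm2 u * norm2 v - dotp u v) by ring.
by rewrite pmulr_rge0 ?subr_ge0 ?mulr_gt0.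
Qed.

(** The set whose supremum is the spectral norm is bounded, by the Frobenius
    norm; otherwise the supremum would carry no information. *)
Lemma spectral_norm_ub m n (B : 'M[R]_(m, n)) (x : 'cV[R]_n) :
  norm2 x <= 1 -> norm2 (B *m x) <= spectral_norm B.
Proof.
move=> x1; apply: ub_le_sup; last by exists x.
exists (Num.sqrt (\sum_i dotp (row i B)^T (row i B)^T)) => _ [y /= y1 <-].
apply: ler_wsqrtr; rewrite {1}/dotp; apply: ler_sum => i _.
have -> : (B *m y) i 0 = dotp (row i B)^T y.
  by rewrite mxE /dotp; apply: eq_bigr => k _; rewrite !mxE.
have sqr_le1 : dotp y y <= 1 by rewrite -sqr_norm2 expr_le1 ?norm2_ge0.
rewrite -expr2; set r := (row i B)^T.
suff : dotp r y ^+ 2 <= dotp r r * dotp y y.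
  by move=> /le_trans; apply; rewrite ler_piMr ?dotp_ge0.
rewrite -!sqr_norm2 -exprMn -ler_sqrt ?sqr_ge0// !sqrtr_sqr.
rewrite [leRHS]ger0_norm ?mulr_ge0 ?norm2_ge0// ler_norml dotp_le_norm2 andbT.
rewrite lerNl -mulN1r -dotpZr (le_trans (dotp_le_norm2 _ _))//.
by rewrite norm2Z normrN1 mul1r.
Qed.

Lemma norm2_mulmx_le m n (B : 'M[R]_(m, n)) (x : 'cV[R]_n) :
  norm2 (B *m x) <= spectral_norm B * norm2 x.
Proof.
have [x0|x0] := eqVneq (norm2 x) 0.
  by rewrite (norm2_eq0 x0) mulmx0 !norm20 mulr0.
have xp : 0 < norm2 x by rewrite lt_neqAle eq_sym x0 norm2_ge0.
rewrite -ler_pdivrMr// mulrC.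
have := @spectral_norm_ub _ _ B ((norm2 x)^-1 *: x).
rewrite -scalemxAr !norm2Z ger0_norm ?invr_ge0 ?norm2_ge0//.
by rewrite mulVf// => /(_ (lexx _)).
Qed.

(** Young's inequality for the coupling through a matrix: half of the error is
    charged to the dual and half to the primal displacement. *)
Lemma dotp_mulmx_young m n (B : 'M[R]_(m, n)) (a : R) (w : 'cV[R]_m)
    (d : 'cV[R]_n) :
  spectral_norm B <= a ->
  2 * dotp w (B *m d) <= a * (dotp w w + dotp d d).
Proof.
move=> Ba; rewrite -!sqr_norm2.
have wp := norm2_ge0 w; have dp := norm2_ge0 d.
have a0 : 0 <= a.
  apply: le_trans Ba; apply: le_trans (spectral_norm_ub B (x := 0) _).
    exact: norm2_ge0.
  by rewrite norm20.
have h1 := dotp_le_norm2 w (B *m d).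
have h2 : norm2 (B *m d) <= a * norm2 d.
  by rewrite (le_trans (norm2_mulmx_le B d))// ler_wpM2r.
have h3 : norm2 w * norm2 (B *m d) <= norm2 w * (a * norm2 d).
  by rewrite ler_wpM2l.
have := mulr_ge0 a0 (sqr_ge0 (norm2 w - norm2 d)).
nra.
Qed.

End EuclideanNorm.

(** * Variational inequalities of the two kinds of subproblems *)

Section Variational.
Context {R : realType}.

Lemma three_point n (y p x : 'cV[R]_n) :
  2 * dotp (y - p) (p - x)
  = dotp (y - x) (y - x) - dotp (y - p) (y - p) - dotp (p - x) (p - x).
Proof.
rewrite /dotp mulr_sumr -!sumrB; apply: eq_bigr => i _.
by rewrite !mxE; ring.
Qed.

Definition convex_along_segments n (h : 'cV[R]_n -> R) : Prop :=
  forall x y t, 0 <= t <= 1 -> h (x + t *: (y - x)) <= h x + t * (h y - h x).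

Lemma convex_function_segment n (h : 'cV[R]_n -> R) :
  convex_function setT h -> convex_along_segments h.
Proof.
move=> hh x y t /andP[t0 t1].
have := hh (Itv01 t0 t1) y x; rewrite !inE => /(_ I I).
rewrite convRE /= => H.
rewrite (_ : x + _ = t *: y + (1 - t) *: x).
  by apply: le_trans H _; rewrite /= /unstable.onem; lra.
by apply/matrixP => i j; rewrite !mxE; ring.
Qed.

Lemma convex_set_segment n (C : set 'cV[R]_n) :
  convex_set C -> forall x y t, 0 <= t <= 1 ->
  C x -> C y -> C (x + t *: (y - x)).
Proof.
move=> hC x y t /andP[t0 t1] Cx Cy.
have := hC y x (Itv01 t0 t1); rewrite !inE => /(_ Cy Cx).
rewrite (_ : x + _ = t *: y + (1 - t) *: x)//.
by apply/matrixP => i j; rewrite !mxE; ring.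
Qed.

Lemma ge0_of_small_perturb (a c : R) :
  (forall t, 0 < t <= 1 -> 0 <= a + t * c) -> 0 <= a.
Proof.
move=> H; rewrite leNgt; apply/negP => a0.
have c0 : 0 < c by have := H 1; rewrite ltr01 lexx => /(_ isT); lra.
(* For this value of [t], [a + t c] equals [a / 2]. *)
have h : 0 < - a / (2 * c) by rewrite divr_gt0//; lra.
have h1 := H 1; rewrite ltr01 lexx in h1; have {}h1 := h1 isT.
have /H : 0 < - a / (2 * c) <= 1.
  by rewrite h ler_pdivrMr; lra.
have -> : - a / (2 * c) * c = - a / 2 by field; rewrite gt_eqF.
lra.
Qed.

(** First-order optimality of a proximal step, obtained without derivatives by
    comparing the minimizer with nearby points of a segment. *)
Lemma prox_variational n (C : set 'cV[R]_n) (h : 'cV[R]_n -> R) (rho : R)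
    (x p : 'cV[R]_n) :
  0 < rho -> convex_set C -> convex_along_segments h ->
  is_argmin C (fun y => h y + (2 * rho)^-1 * norm2 (y - x) ^+ 2) p ->
  forall y, C y -> h p - h y <= rho^-1 * dotp (y - p) (p - x).
Proof.
move=> rho0 cC ch [Cp hp] y Cy; rewrite -subr_ge0.
(* The quadratic term of the objective along the segment is of second order
   in [t] and disappears in the limit. *)
apply: (@ge0_of_small_perturb _ ((2 * rho)^-1 * dotp (y - p) (y - p))).
move=> t /andP[t0 t1].
have t01 : 0 <= t <= 1 by rewrite ltW.
have := hp _ (convex_set_segment cC t01 Cp Cy).
have := ch p y t t01; rewrite !sqr_norm2.
have -> : dotp (p + t *: (y - p) - x) (p + t *: (y - p) - x)
  = dotp (p - x) (p - x) + 2 * t * dotp (y - p) (p - x)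
    + t ^+ 2 * dotp (y - p) (y - p).
  rewrite /dotp !mulr_sumr -!big_split; apply: eq_bigr => i _ /=.
  by rewrite !mxE; ring.
set D := dotp (y - p) (p - x); set E := dotp (y - p) (y - p).
set P := dotp (p - x) (p - x).
move=> h1 h2.
have h3 : 0 <= t * (rho^-1 * D - (h p - h y) + t * ((2 * rho)^-1 * E)).
  have -> : t * (rho^-1 * D - (h p - h y) + t * ((2 * rho)^-1 * E))
    = t * (h y - h p) + ((2 * rho)^-1 * (P + 2 * t * D + t ^+ 2 * E)
      - (2 * rho)^-1 * P) by field; rewrite gt_eqF.
  lra.
by rewrite pmulr_rge0 in h3.
Qed.

(** The set [K] is the whole space for multipliers of equalities and the
    nonnegative orthant for multipliers of inequalities; the inequality says
    that [v] is the projection of [u + rho *: G] on [K]. *)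
Definition projected_step n (K : set 'cV[R]_n) (rho : R) (u G v : 'cV[R]_n) :=
  K v /\ forall q, K q -> 0 <= dotp (q - v) (v - (u + rho *: G)).

Definition nneg_orthant n : set 'cV[R]_n := [set v | forall j, 0 <= v j 0].

Lemma projected_step_setT n (rho : R) (u G : 'cV[R]_n) :
  projected_step setT rho u G (u + rho *: G).
Proof. by split=> // q _; rewrite subrr dotp0r. Qed.

Lemma projected_step_nneg n (rho : R) (u G v : 'cV[R]_n) :
  (forall j, is_proj_nneg (u j 0 + rho * G j 0) (v j 0)) ->
  projected_step (@nneg_orthant n) rho u G v.
Proof.
move=> hv; split=> [j|q q0]; first by have [] := hv j.
apply: sumr_ge0 => j _; rewrite !mxE.
have [/= v0 hp] := hv j; have qj := q0 j.
set s := u j 0 + rho * G j 0 in hp *.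
have [s0|s0] := leP 0 s.
  have := hp s s0; rewrite subrr normr0 normr_le0 => /eqP ->.
  by rewrite mulr0.
have := hp 0 (lexx _); rewrite sub0r (gtr0_norm (x := - s)); last by lra.
rewrite ger0_norm; last by lra.
by move=> ps; apply: mulr_ge0; lra.
Qed.

(** The extragradient estimate for a dual block, with residual [G] in the
    predictor and [G'] in the corrector.  The predictor inequality is tested at
    the corrected point, the corrector inequality at the target [q]. *)
Lemma extragradient n (K : set 'cV[R]_n) (rho : R) (u v u' q G G' : 'cV[R]_n) :
  projected_step K rho u G v -> projected_step K rho u G' u' -> K q ->
  2 * rho * dotp (q - v) G' <=
  dotp (u - q) (u - q) - dotp (u' - q) (u' - q) - dotp (v - u) (v - u)
  - dotp (u' - v) (u' - v) + 2 * rho * dotp (u' - v) (G' - G).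
Proof.
move=> [_ hv] [Ku' hu'] Kq.
have := hv _ Ku'; have := hu' _ Kq.
rewrite -[_ <= _ + _]subr_ge0 => h1 h2.
suff -> : dotp (u - q) (u - q) - dotp (u' - q) (u' - q) - dotp (v - u) (v - u)
    - dotp (u' - v) (u' - v) + 2 * rho * dotp (u' - v) (G' - G)
    - 2 * rho * dotp (q - v) G'
  = 2 * dotp (u' - v) (v - (u + rho *: G))
    + 2 * dotp (q - u') (u' - (u + rho *: G')) by lra.
rewrite /dotp !mulr_sumr -!sumrB -!big_split -!sumrB.
by apply: eq_bigr => i _ /=; rewrite !mxE; ring.
Qed.

End Variational.

(** * Entrywise convergence and compactness along an ultrafilter *)

Section Convergence.
Context {R : realType}.

Lemma cvg_mx_coord {T : Type} {F : set_system T} {FF : Filter F} (p q : nat)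
    (u : T -> 'M[R]_(p, q)) (l : 'M[R]_(p, q)) :
  u @ F --> l <-> forall i j, (fun t => u t i j) @ F --> l i j.
Proof.
split=> [ul i j|ul].
  apply: (continuous_cvg FF (h := fun B : 'M[R]_(p, q) => B i j) _ ul).
  exact: coord_continuous.
move=> B [P hP PB].
have : \forall t \near F, forall i j, P i j (u t i j).
  apply: (@filter_forall _ _ (fun i t => forall j, P i j (u t i j))) => i.
  apply: (@filter_forall _ _ (fun j t => P i j (u t i j))) => j.
  exact: (ul i j _ (hP i j)).
by apply: filterS => t Pt; apply: PB.
Qed.

Lemma cvg_sum_fin {T : Type} {F : set_system T} {FF : Filter F} (I : finType)
    (u : I -> T -> R) (l : I -> R) :
  (forall i, u i @ F --> l i) -> (fun t => \sum_i u i t) @ F --> \sum_i l i.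
Proof. by move=> ul; apply: (cvg_big add_continuous) => i _; exact: ul. Qed.

Lemma cvg_dotp {T : Type} {F : set_system T} {FF : Filter F} n
    (u v : T -> 'cV[R]_n) (a b : 'cV[R]_n) :
  u @ F --> a -> v @ F --> b -> (fun t => dotp (u t) (v t)) @ F --> dotp a b.
Proof.
move=> /cvg_mx_coord ua /cvg_mx_coord vb.
apply: (cvg_sum_fin (u := fun i t => u t i 0 * v t i 0)) => i.
by apply: cvgM; [exact: ua|exact: vb].
Qed.

Lemma cvg_mulmx {T : Type} {F : set_system T} {FF : Filter F} p q
    (B : 'M[R]_(p, q)) (u : T -> 'cV[R]_q) (a : 'cV[R]_q) :
  u @ F --> a -> (fun t => B *m u t) @ F --> B *m a.
Proof.
move=> /cvg_mx_coord ua; apply/cvg_mx_coord => i j; rewrite !mxE.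
under eq_fun do rewrite mxE.
apply: (cvg_sum_fin (u := fun k t => B i k * u t k j)) => k.
by apply: cvgM; [exact: cvg_cst|exact: ua].
Qed.

Lemma cvg_of_sqdist {T : Type} {F : set_system T} {FF : Filter F} n
    (u : T -> 'cV[R]_n) (a : 'cV[R]_n) (d : T -> R) :
  (\forall t \near F, dotp (u t - a) (u t - a) <= d t) -> d @ F --> 0 ->
  u @ F --> a.
Proof.
move=> ud d0; apply/cvg_mx_coord => i j; rewrite ord1.
apply/cvgrPdistC_lt => e e0.
have e2 : 0 < e ^+ 2 by rewrite exprn_gt0.
have /cvgr0Pnorm_lt/(_ _ e2) de := d0.
apply: filterS (filterI ud de) => t [udt dt].
have := sqr_coord_le (u t - a) i; rewrite !mxE => h.
rewrite -(ltr_pXn2r (n := 2)) ?nnegrE ?(ltW e0)//.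
rewrite real_normK ?num_real//.
by rewrite (le_lt_trans (le_trans h udt))// (le_lt_trans (ler_norm _)).
Qed.

(** Along an ultrafilter a cluster point is a limit, so a single ultrafilter
    serves as a common convergent subsequence for all blocks of the state. *)
Lemma ultra_cvg_bounded {T : Type} {U : set_system T} (UU : UltraFilter U)
    (u : T -> R) (a c : R) :
  (\forall t \near U, a <= u t <= c) -> exists l : R, u @ U --> l.
Proof.
move=> ub; have PU : ProperFilter U := @ultra_proper _ _ UU.
have uac : (u @ U) `[a, c]%classic.
  by apply: filterS ub => t; rewrite /= in_itv.
have [l [_ ul]] := segment_compact _ uac.
exists l => B nB; case: (in_ultra_setVsetC (u @^-1` B) UU) => // UB.
have [y [By yB]] := ul (~` B) B UB nB.
by case: By.
Qed.

Lemma ultra_cvg_sqbounded {T : Type} {U : set_system T} (UU : UltraFilter U) n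
    (u : T -> 'cV[R]_n) (a : 'cV[R]_n) (c : R) :
  (\forall t \near U, dotp (u t - a) (u t - a) <= c) ->
  exists l : 'cV[R]_n, u @ U --> l.
Proof.
move=> uc; have PU : ProperFilter U := @ultra_proper _ _ UU.
have coord i : exists l : R, (fun t => u t i 0) @ U --> l.
  apply: (@ultra_cvg_bounded _ _ UU _ (a i 0 - (c + 1)) (a i 0 + (c + 1))).
  apply: filterS uc => t.
  have := sqr_coord_le (u t - a) i; rewrite !mxE => h /(le_trans h) {}h.
  set e := u t i 0 - a i 0 in h.
  (* [e ^ 2 + 1 >= |e|], from the squares of [2 e + 1] and [2 e - 1]. *)
  have p1 := sqr_ge0 (2 * e + 1); have p2 := sqr_ge0 (2 * e - 1).
  have -> : u t i 0 = a i 0 + e by rewrite /e; ring.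
  rewrite expr2 in h; rewrite expr2 in p1; rewrite expr2 in p2.
  by apply/andP; split; lra.
have [l hl] := choice coord.
exists (\col_i l i); apply/cvg_mx_coord => i j; rewrite ord1 mxE.
exact: hl.
Qed.

End Convergence.
(** * One iteration decreases the distance to every saddle point *)

Section Iteration.
Unset Implicit Arguments.
Context {R : realType} {N M m : nat} {n : 'I_N -> nat}.
Variables (X : forall i, set 'cV[R]_(n i)) (f : forall i, 'cV[R]_(n i) -> R).
Variables (A : forall i, 'M[R]_(m, n i)) (b : 'cV[R]_m).
Variable g : 'I_M -> forall i, 'cV[R]_(n i) -> R.
Variable rho : R.
Set Implicit Arguments.

Local Notation primal := (forall i, 'cV[R]_(n i)).
Local Notation lag := (lagrangian f A b g).

Definition eq_residual (x : primal) : 'cV[R]_m := \sum_(i < N) A i *m x i - b.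

Definition ineq_residual (x : primal) : 'cV[R]_M :=
  \col_j \sum_(i < N) g j i (x i).

Definition sqdist (x y : primal) : R :=
  \sum_(i < N) dotp (x i - y i) (x i - y i).

Lemma lagrangianE x lam mu :
  lag x lam mu = \sum_(i < N) f i (x i) + dotp lam (eq_residual x)
    + dotp mu (ineq_residual x).
Proof. by congr (_ + _); apply: eq_bigr => j _; rewrite mxE. Qed.

Lemma lagrangian_dual_sub x lam mu lam' mu' :
  lag x lam' mu' - lag x lam mu
  = dotp (lam' - lam) (eq_residual x) + dotp (mu' - mu) (ineq_residual x).
Proof.
rewrite !lagrangianE.
have dotpBl p (u v w : 'cV[R]_p) : dotp (u - v) w = dotp u w - dotp v w.
  by rewrite /dotp -sumrB; apply: eq_bigr => i _; rewrite !mxE mulrBl.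
by rewrite !dotpBl; ring.
Qed.

Lemma lagrangian_separable x lam mu :
  lag x lam mu
  = \sum_(i < N) (f i (x i) + dotp lam (A i *m x i)
                  + \sum_(j < M) mu j 0 * g j i (x i)) - dotp lam b.
Proof.
rewrite /lagrangian dotpBr dotp_sumr !big_split /=.
rewrite [X in _ = _ + X - _]exchange_big /=.
under [X in _ = _ + X - _]eq_bigr do rewrite -mulr_sumr.
by ring.
Qed.

(** One iteration with its predictor [(gam, nu)] made explicit and each of its
    subproblems replaced by the variational inequality of its solution. *)
Definition pcpm_variational (x : primal) lam mu gam nu (x' : primal) lam' mu' :=
  [/\ forall i, X i (x' i),
      forall y : primal, (forall i, X i (y i)) ->
        lag x' gam nu - lag y gam nu
        <= rho^-1 * \sum_(i < N) dotp (y i - x' i) (x' i - x i),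
      projected_step setT rho lam (eq_residual x) gam /\
      projected_step (@nneg_orthant R M) rho mu (ineq_residual x) nu,
      projected_step setT rho lam (eq_residual x') lam'
    & projected_step (@nneg_orthant R M) rho mu (ineq_residual x') mu'].

Lemma pcpm_step_variational x lam mu x' lam' mu' :
  0 < rho -> (forall i, convex_set (X i)) ->
  (forall i, convex_function setT (f i)) ->
  (forall j i, convex_function setT (g j i)) ->
  pcpm_step X f A b g rho x lam mu x' lam' mu' ->
  exists gam nu, pcpm_variational x lam mu gam nu x' lam' mu'.
Proof.
move=> rho0 cX cf cg [gam [nu [hgam hnu hx' hlam' hmu']]].
exists gam, nu; split.
- by move=> i; have [] := hx' i.
- move=> y Xy; rewrite !lagrangian_separable mulr_sumr.
  rewrite opprD addrACA subrr addr0 -sumrB; apply: ler_sum => i _.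
  apply: (prox_variational rho0 (cX i) _ (hx' i) (Xy i)).
  move=> u v t t01.
  have hf := convex_function_segment (cf i) u v t01.
  have hg : \sum_(j < M) nu j 0 * g j i (u + t *: (v - u)) <=
      \sum_(j < M) (nu j 0 * g j i u + t * (nu j 0 * g j i v - nu j 0 * g j i u)).
    apply: ler_sum => j _; have [/= nu0 _] := hnu j.
    have := ler_wpM2l nu0 (convex_function_segment (cg j i) u v t01).
    by lra.
  rewrite big_split -mulr_sumr sumrB /= in hg.
  rewrite mulmxDr -scalemxAr mulmxBr dotpDr dotpZr dotpBr.
  by lra.
- split; first by rewrite hgam; exact: projected_step_setT.
  by apply: projected_step_nneg => j; rewrite mxE; exact: hnu.
- by rewrite hlam'; exact: projected_step_setT.
- by apply: projected_step_nneg => j; rewrite mxE; exact: hmu'.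
Qed.

(** The dual term is counted once for each of the [N] blocks, the primal one
    only once: this asymmetry yields the different denominators in the bound on
    the step size. *)
Lemma eq_residual_coupling (a : R) (x x' : primal) (w : 'cV[R]_m) :
  (forall i, spectral_norm (A i) <= a) ->
  2 * dotp w (eq_residual x' - eq_residual x)
  <= N%:R * a * dotp w w + a * sqdist x' x.
Proof.
move=> hA.
have -> : eq_residual x' - eq_residual x = \sum_(i < N) A i *m (x' i - x i).
  under [RHS]eq_bigr do rewrite mulmxBr.
  by rewrite sumrB /eq_residual opprB addrA subrK.
rewrite dotp_sumr mulr_sumr.
have -> : N%:R * a * dotp w w + a * sqdist x' x
  = \sum_(i < N) a * (dotp w w + dotp (x' i - x i) (x' i - x i)).
  rewrite -mulr_sumr big_split /= sumr_const card_ord -mulr_natl /sqdist.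
  by ring.
by apply: ler_sum => i _; exact: dotp_mulmx_young.
Qed.

(** Here the primal displacement is also counted once per constraint, hence the
    factor [M]. *)
Lemma ineq_residual_coupling (l : R) (x x' : primal) (w : 'cV[R]_M) :
  (forall j i, `|g j i (x' i) - g j i (x i)| <= l * norm2 (x' i - x i)) ->
  0 <= l ->
  2 * dotp w (ineq_residual x' - ineq_residual x)
  <= N%:R * l * dotp w w + M%:R * l * sqdist x' x.
Proof.
move=> hg l0.
have -> : N%:R * l * dotp w w + M%:R * l * sqdist x' x
  = \sum_(j < M) \sum_(i < N)
      l * (w j 0 ^+ 2 + dotp (x' i - x i) (x' i - x i)).
  under [RHS]eq_bigr => j _.
    rewrite -mulr_sumr big_split /= sumr_const card_ord -mulr_natl.
    rewrite -/(sqdist x' x).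
    over.
  rewrite -mulr_sumr big_split /= sumr_const card_ord -mulr_natl -mulr_sumr.
  rewrite /dotp; under eq_bigr do rewrite -expr2.
  by ring.
rewrite {1}/dotp mulr_sumr; apply: ler_sum => j _.
rewrite !mxE -sumrB !mulr_sumr; apply: ler_sum => i _.
rewrite -sqr_norm2.
have h1 : w j 0 * (g j i (x' i) - g j i (x i))
    <= `|w j 0| * (l * norm2 (x' i - x i)).
  by rewrite (le_trans (ler_norm _))// normrM ler_wpM2l.
have h2 := mulr_ge0 l0 (sqr_ge0 (`|w j 0| - norm2 (x' i - x i))).
have h3 : `|w j 0| ^+ 2 = w j 0 ^+ 2 by rewrite real_normK ?num_real.
nra.
Qed.

Definition pcpm_increment (x : primal) (lam : 'cV[R]_m) (mu : 'cV[R]_M)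
    (gam : 'cV[R]_m) (nu : 'cV[R]_M)
    (x' : primal) (lam' : 'cV[R]_m) (mu' : 'cV[R]_M) : R :=
  sqdist x' x + dotp (gam - lam) (gam - lam) + dotp (lam' - gam) (lam' - gam)
  + dotp (nu - mu) (nu - mu) + dotp (mu' - nu) (mu' - nu).

Definition state_sqdist (xs : primal) (lams : 'cV[R]_m) (mus : 'cV[R]_M)
    (x : primal) lam mu : R :=
  sqdist x xs + dotp (lam - lams) (lam - lams) + dotp (mu - mus) (mu - mus).

(** Fejer monotonicity.  The primal inequality at the saddle point, the two
    extragradient estimates and the saddle inequalities cancel up to the
    coupling terms between primal displacement and dual correction, which the
    step-size bound absorbs into the increments. *)
Lemma pcpm_fejer (a l eps : R) xs lams mus
    (x : primal) lam mu gam nu (x' : primal) lam' mu' :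
  0 < rho -> 0 <= l -> (forall i, spectral_norm (A i) <= a) ->
  (forall j i, `|g j i (x' i) - g j i (x i)| <= l * norm2 (x' i - x i)) ->
  [/\ rho * (a + M%:R * l) <= 1 - eps, rho * (N%:R * a) <= 1 - eps
    & rho * (N%:R * l) <= 1 - eps] -> eps <= 1 ->
  saddle_point X f A b g xs lams mus ->
  pcpm_variational x lam mu gam nu x' lam' mu' ->
  state_sqdist xs lams mus x' lam' mu'
    + eps * pcpm_increment x lam mu gam nu x' lam' mu'
  <= state_sqdist xs lams mus x lam mu.
Proof.
move=> rho0 l0 hA hg [b1 b2 b3] eps1 [Xxs mus0 sd sp].
move=> [Xx' px' [hgam hnu] hlam' hmu'].
have nu0 := hnu.1.
have H1 : 2 * rho * (lag x' gam nu - lag xs gam nu)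
    <= sqdist x xs - sqdist x' xs - sqdist x' x.
  have -> : sqdist x xs - sqdist x' xs - sqdist x' x
    = 2 * \sum_(i < N) dotp (xs i - x' i) (x' i - x i).
    rewrite /sqdist -!sumrB mulr_sumr; apply: eq_bigr => i _.
    have sqC p (u v : 'cV[R]_p) : dotp (u - v) (u - v) = dotp (v - u) (v - u).
      by apply: eq_bigr => k _; rewrite !mxE; ring.
    by rewrite three_point (sqC _ (xs i)) (sqC _ (xs i) (x' i)).
  have := ler_wpM2l (ltW rho0) (px' _ Xxs).
  by rewrite mulrA divff ?gt_eqF// mul1r; lra.
have H2 : 0 <= rho * (lag x' lams mus - lag xs gam nu).
  by rewrite mulr_ge0 ?(ltW rho0)// subr_ge0 (le_trans (sd gam nu nu0))// sp.
have H3 := lagrangian_dual_sub x' gam nu lams mus.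
have H4 := extragradient (q := lams) hgam hlam' I.
have H5 := extragradient hnu hmu' mus0.
have H6 := ler_wpM2l (ltW rho0) (eq_residual_coupling x x' (lam' - gam) hA).
have H7 := ler_wpM2l (ltW rho0) (ineq_residual_coupling (mu' - nu) hg l0).
have D0 : 0 <= sqdist x' x by apply: sumr_ge0 => i _; exact: dotp_ge0.
have W0 := dotp_ge0 (lam' - gam); have Z0 := dotp_ge0 (mu' - nu).
have G0 := dotp_ge0 (gam - lam); have V0 := dotp_ge0 (nu - mu).
have B1 := ler_wpM2r D0 b1; have B2 := ler_wpM2r W0 b2.
have B3 := ler_wpM2r Z0 b3.
have G1 := ler_wpM2r G0 eps1; have V1 := ler_wpM2r V0 eps1.
(* [H1 + 2 H2] has the multiplier gap [H3], which [H4] and [H5] split into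
   distances and couplings; [H6] and [H7] bound the couplings by increments,
   with coefficients controlled by [B1], [B2], [B3], and by [G1], [V1] for the
   increments without coupling. *)
rewrite /state_sqdist /pcpm_increment; nra.
Qed.

End Iteration.

(** * Limit points are saddle points *)

Section Limit.
Unset Implicit Arguments.
Context {R : realType} {N M m : nat} {n : 'I_N -> nat}.
Variables (X : forall i, set 'cV[R]_(n i)) (f : forall i, 'cV[R]_(n i) -> R).
Variables (A : forall i, 'M[R]_(m, n i)) (b : 'cV[R]_m).
Variable g : 'I_M -> forall i, 'cV[R]_(n i) -> R.
Set Implicit Arguments.
Hypothesis fcont : forall i, continuous (f i).
Hypothesis gcont : forall j i, continuous (g j i).
Context {T : Type} {F : set_system T} {FF : ProperFilter F}.

Lemma cvg_eq_residual (x : T -> forall i, 'cV[R]_(n i)) xs :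
  (forall i, (fun t => x t i) @ F --> xs i) ->
  (fun t => eq_residual A b (x t)) @ F --> eq_residual A b xs.
Proof.
move=> xx; apply/cvg_mx_coord => i j.
rewrite /eq_residual !mxE summxE.
under eq_fun do rewrite !mxE summxE.
apply: cvgB; last exact: cvg_cst.
apply: (cvg_sum_fin (u := fun k t => (A k *m x t k) i j)) => k.
have /cvg_mx_coord : (fun t => A k *m x t k) @ F --> A k *m xs k.
  exact: cvg_mulmx.
by apply.
Qed.

Lemma cvg_ineq_residual (x : T -> forall i, 'cV[R]_(n i)) xs :
  (forall i, (fun t => x t i) @ F --> xs i) ->
  (fun t => ineq_residual g (x t)) @ F --> ineq_residual g xs.
Proof.
move=> xx; apply/cvg_mx_coord => j k; rewrite mxE.
under eq_fun do rewrite mxE.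
apply: (cvg_sum_fin (u := fun i t => g j i (x t i))) => i.
by apply: (continuous_cvg _ (h := g j i) _ (xx i)); exact: gcont.
Qed.

Lemma cvg_lagrangian (x : T -> forall i, 'cV[R]_(n i)) lam mu xs lams mus :
  (forall i, (fun t => x t i) @ F --> xs i) ->
  lam @ F --> lams -> mu @ F --> mus ->
  (fun t => lagrangian f A b g (x t) (lam t) (mu t)) @ F
    --> lagrangian f A b g xs lams mus.
Proof.
move=> xx ll mm; rewrite lagrangianE.
under eq_fun do rewrite lagrangianE.
apply: cvgD; last exact: cvg_dotp mm (cvg_ineq_residual xx).
apply: cvgD; last exact: cvg_dotp ll (cvg_eq_residual xx).
apply: (cvg_sum_fin (u := fun i t => f i (x t i))) => i.
by apply: (continuous_cvg _ (h := f i) _ (xx i)); exact: fcont.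
Qed.

Lemma cvg_cvB p (u v : T -> 'cV[R]_p) (a c : 'cV[R]_p) :
  u @ F --> a -> v @ F --> c -> (fun t => u t - v t) @ F --> a - c.
Proof.
move=> /cvg_mx_coord ua /cvg_mx_coord vc; apply/cvg_mx_coord => i j.
rewrite !mxE; under eq_fun do rewrite !mxE.
by apply: cvgB; [exact: ua|exact: vc].
Qed.

(** When the step no longer moves, the projection inequality degenerates to
    optimality of the fixed point in the direction of the residual. *)
Lemma projected_step_limit p (K : set 'cV[R]_p) (rho : R)
    (u u' G : T -> 'cV[R]_p) (us Gs : 'cV[R]_p) :
  0 < rho -> (forall t, projected_step K rho (u t) (G t) (u' t)) ->
  u @ F --> us -> u' @ F --> us -> G @ F --> Gs ->
  forall q, K q -> dotp (q - us) Gs <= 0.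
Proof.
move=> rho0 hp uu uu' GG q Kq.
have lim : (fun t => dotp (q - u' t) (u' t - u t) - rho * dotp (q - u' t) (G t))
    @ F --> dotp (q - us) (us - us) - rho * dotp (q - us) Gs.
  have qu : (fun t => q - u' t) @ F --> q - us.
    by apply: cvg_cvB => //; exact: cvg_cst.
  apply: cvgB; first by apply: cvg_dotp => //; exact: cvg_cvB.
  by apply: cvgM; [exact: cvg_cst|exact: cvg_dotp].
have : 0 <= dotp (q - us) (us - us) - rho * dotp (q - us) Gs.
  apply: (cvgr_to_ge lim); apply: filterE => t.
  by have := (hp t).2 _ Kq; rewrite opprD addrA [X in 0 <= X -> _]dotpBr dotpZr.
by rewrite subrr dotp0r sub0r oppr_ge0 pmulr_rle0.
Qed.

(** The saddle inequality in the multipliers comes from the corrector; the one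
    in the primal variable comes from the proximal step, whose objective is the
    Lagrangian at the predicted multipliers, and these have the same limit as
    the corrected ones. *)
Lemma saddle_point_of_limit (rho : R) (x x' : T -> forall i, 'cV[R]_(n i))
    (lam gam lam' : T -> 'cV[R]_m) (mu nu mu' : T -> 'cV[R]_M) xs lams mus :
  0 < rho -> (forall i, closed (X i)) ->
  (forall t, pcpm_variational X f A b g rho (x t) (lam t) (mu t)
     (gam t) (nu t) (x' t) (lam' t) (mu' t)) ->
  (forall i, (fun t => x t i) @ F --> xs i) ->
  (forall i, (fun t => x' t i) @ F --> xs i) ->
  lam @ F --> lams -> gam @ F --> lams -> lam' @ F --> lams ->
  mu @ F --> mus -> nu @ F --> mus -> mu' @ F --> mus ->
  saddle_point X f A b g xs lams mus.
Proof.
move=> rho0 clX hv xx xx' ll gl ll' mm nm mm'; split.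
- move=> i; apply: (@closed_cvg _ _ F _ (fun t => x' t i) (X i) (clX i) _ _ (xx' i)).
  by apply: filterE => t; have [] := hv t.
- move=> j; move: (mm') => /cvg_mx_coord/(_ j 0) mj.
  apply: (cvgr_to_ge mj); apply: filterE => t.
  by have [_ _ _ _ [+ _]] := hv t; exact.
- move=> lam1 mu1 mu10; rewrite -subr_le0 lagrangian_dual_sub.
  apply: ler_wnDl.
    apply: (projected_step_limit (K := setT) rho0 _ ll ll' (cvg_eq_residual xx')) => //.
    by move=> t; have [] := hv t.
  apply: (projected_step_limit (K := @nneg_orthant R M) rho0 _ mm mm'
    (cvg_ineq_residual xx') mu10).
  by move=> t; have [] := hv t.
- move=> y Xy; rewrite -subr_ge0.
  have lim : (fun t => lagrangian f A b g y (gam t) (nu t)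
        - lagrangian f A b g (x' t) (gam t) (nu t)
        + rho^-1 * \sum_(i < N) dotp (y i - x' t i) (x' t i - x t i)) @ F -->
      lagrangian f A b g y lams mus - lagrangian f A b g xs lams mus
        + rho^-1 * \sum_(i < N) dotp (y i - xs i) (xs i - xs i).
    apply: cvgD.
      apply: cvgB; first by apply: cvg_lagrangian => // i; exact: cvg_cst.
      exact: cvg_lagrangian.
    apply: cvgM; first exact: cvg_cst.
    apply: (cvg_sum_fin (u := fun i t => dotp (y i - x' t i) (x' t i - x t i))).
    move=> i; apply: cvg_dotp; last exact: cvg_cvB.
    by apply: cvg_cvB => //; exact: cvg_cst.
  have := cvgr_to_ge (b := 0) lim; rewrite big1 ?mulr0 ?addr0; last first.
    by move=> i _; rewrite subrr dotp0r.
  apply; apply: filterE => t.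
  by have [_ /(_ _ Xy) h _ _ _] := hv t; lra.
Qed.

End Limit.
(** * Convergence of the whole sequence *)

Section MonotoneSequences.
Context {R : realType}.

Lemma cvg_increments0 (v : nat -> R) :
  (forall k, v k.+1 <= v k) -> (forall k, 0 <= v k) ->
  (fun k => v k - v k.+1) @ \oo --> 0.
Proof.
move=> vd v0.
have hd : {homo v : p q / (p <= q)%N >-> q <= p}.
  by apply/nonincreasing_seqP.
have vl := nonincreasing_is_cvgn hd.
have {}vl : cvgn v by apply: vl; exists 0 => _ [k _ <-].
rewrite -(subrr (limn v)); apply: cvgB => //.
by rewrite cvg_shiftS.
Qed.

(** Sets of a proper filter are nonempty, so some value is small, and it bounds
    all later ones. *)
Lemma nonincreasing_cvg0_of_filter (v : nat -> R) (F : set_system nat) :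
  ProperFilter F -> (forall k, v k.+1 <= v k) -> (forall k, 0 <= v k) ->
  v @ F --> 0 -> v @ \oo --> 0.
Proof.
move=> PF vd v0 vF.
have hd : {homo v : p q / (p <= q)%N >-> q <= p}.
  by apply/nonincreasing_seqP.
apply/cvgr0Pnorm_lt => e e0.
have /cvgr0Pnorm_lt/(_ _ e0) hF := vF.
have [k vk] := filter_ex hF.
exists k => // p /= kp.
by rewrite ger0_norm// (le_lt_trans (hd _ _ kp))// (le_lt_trans (ler_norm _)).
Qed.

End MonotoneSequences.

Lemma cvg_of_sqdist_cvg {R : realType} {T : Type} {F : set_system T}
    {FF : Filter F} n (u v : T -> 'cV[R]_n) (a : 'cV[R]_n) (d : T -> R) :
  u @ F --> a -> (forall t, dotp (v t - u t) (v t - u t) <= d t) ->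
  d @ F --> 0 -> v @ F --> a.
Proof.
move=> ua vd d0.
have vu : (fun t => v t - u t) @ F --> (0 : 'cV[R]_n).
  by apply: (cvg_of_sqdist _ d0); apply: filterE => t; rewrite subr0.
apply/cvg_mx_coord => i j.
have -> : (fun t => v t i j) = (fun t => u t i j + (v t - u t) i j).
  by apply/funext => t; rewrite !mxE; ring.
have -> : a i j = a i j + (0 : 'cV[R]_n) i j by rewrite mxE addr0.
by apply: cvgD; [move/cvg_mx_coord : ua|move/cvg_mx_coord : vu]; exact.
Qed.

(** The three bounds hidden in the extended-real minimum; a vanishing
    denominator gives [+oo] there and a trivial bound here. *)
Lemma le_step_bound (R : realType) (N M : nat) (eps Am Lm rho : R) :
  0 < eps < 1 -> 0 <= Am -> 0 <= Lm -> 0 < rho ->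
  (rho%:E <= step_bound N M eps Am Lm)%E ->
  [/\ rho * (Am + M%:R * Lm) <= 1 - eps, rho * (N%:R * Am) <= 1 - eps
    & rho * (N%:R * Lm) <= 1 - eps].
Proof.
move=> /andP[e0 e1] A0 L0 r0.
have div (d : R) : 0 <= d -> (rho%:E <= (1 - eps)%:E / d%:E)%E ->
    rho * d <= 1 - eps.
  rewrite le_eqVlt => /predU1P[<-|d0]; first by rewrite mulr0 => _; lra.
  by rewrite inver gt_eqF// -EFinM lee_fin ler_pdivlMr.
rewrite /step_bound !le_min => /andP[h1 /andP[h2 h3]].
by split; apply: div => //; rewrite ?addr_ge0 ?mulr_ge0.
Qed.

Theorem theorem2p4 (R : realType) (N M m : nat) (n : 'I_N -> nat)
  (X : forall i : 'I_N, set 'cV[R]_(n i))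
  (f : forall i : 'I_N, 'cV[R]_(n i) -> R)
  (A : forall i : 'I_N, 'M[R]_(m, n i)) (b : 'cV[R]_m)
  (g : 'I_M -> forall i : 'I_N, 'cV[R]_(n i) -> R)
  (hXclosed : forall i, closed (X i))
  (hXconvex : forall i, convex_set (X i))
  (hfcont : forall i, continuous (f i))
  (hfconvex : forall i, convex_function setT (f i))
  (hgcont : forall j i, continuous (g j i))
  (hgconvex : forall j i, convex_function setT (g j i))
  (hSlater : exists xbar : forall i : 'I_N, 'cV[R]_(n i),
     [/\ forall i, relint (X i) (xbar i),
         \sum_(i < N) A i *m xbar i = b
       & forall j, \sum_(i < N) g j i (xbar i) < 0])
  (L : 'I_M -> 'I_N -> R)
  (hLip : forall j i (x y : 'cV[R]_(n i)), X i x -> X i y ->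
     `|g j i x - g j i y| <= L j i * norm2 (x - y))
  (hsaddle : exists xs lams mus, saddle_point X f A b g xs lams mus)
  (eps : R) (heps : 0 < eps < 1)
  (rho : R) (hrho_gt0 : 0 < rho)
  (hrho_le : (rho%:E <= step_bound N M eps (Amax A) (Lmax L))%E)
  (x : nat -> forall i : 'I_N, 'cV[R]_(n i))
  (lam : nat -> 'cV[R]_m) (mu : nat -> 'cV[R]_M)
  (hstep : forall k : nat, pcpm_step X f A b g rho
     (x k) (lam k) (mu k) (x k.+1) (lam k.+1) (mu k.+1)) :
  exists xs lams mus,
    [/\ saddle_point X f A b g xs lams mus,
        forall i, (fun k => x k i) @ \oo --> xs i,
        lam @ \oo --> lams
      & mu @ \oo --> mus].
Proof.
have [xs0 [lams0 [mus0 sp0]]] := hsaddle.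
have A0 : 0 <= Amax A by exact: bigmax_ge_id.
have hA i : spectral_norm (A i) <= Amax A by exact: le_bigmax.
have hL j i : L j i <= Lmax L.
  apply: le_trans (le_bigmax 0 (fun j => \big[Num.max/0]_(i < N) L j i) j).
  exact: (le_bigmax 0 (fun i => L j i) i).
have L0 : 0 <= Lmax L by exact: bigmax_ge_id.
have bounds := le_step_bound heps A0 L0 hrho_gt0 hrho_le.
have /choice[p hp] : forall k, exists p : 'cV[R]_m * 'cV[R]_M,
    pcpm_variational X f A b g rho (x k) (lam k) (mu k) p.1 p.2
      (x k.+1) (lam k.+1) (mu k.+1).
  move=> k.
  have [gam [nu h]] := pcpm_step_variational hrho_gt0 hXconvex hfconvex
    hgconvex (hstep k).
  by exists (gam, nu).
(* The starting point need not be feasible, and the Lipschitz bounds only hold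
   on the constraint sets: the estimates start at the first iterate. *)
have Xx k i : X i (x k.+1 i) by have [] := hp k.
pose dist xs lams mus k : R :=
  state_sqdist xs lams mus (x k.+1) (lam k.+1) (mu k.+1).
pose incr k : R := pcpm_increment (x k.+1) (lam k.+1) (mu k.+1)
  (p k.+1).1 (p k.+1).2 (x k.+2) (lam k.+2) (mu k.+2).
have fejer xs lams mus k : saddle_point X f A b g xs lams mus ->
    dist xs lams mus k.+1 + eps * incr k <= dist xs lams mus k.
  move=> sp; have /andP[e0 e1] := heps.
  apply: (pcpm_fejer hrho_gt0 L0 hA _ bounds (ltW e1) sp (hp k.+1)) => j i.
  by apply: le_trans (hLip _ _ _ _ _ _) _ => //; rewrite ler_wpM2r ?norm2_ge0.
have sqdist_ge0 (y z : forall i, 'cV[R]_(n i)) : 0 <= sqdist y z.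
  by apply: sumr_ge0 => i _; exact: dotp_ge0.
have sqdist_ge (y z : forall i, 'cV[R]_(n i)) i :
    dotp (y i - z i) (y i - z i) <= sqdist y z.
  rewrite /sqdist (bigD1 i)//= lerDl.
  by apply: sumr_ge0 => k _; exact: dotp_ge0.
have dist_ge0 xs lams mus k : 0 <= dist xs lams mus k.
  by rewrite !addr_ge0 ?dotp_ge0.
have incr_ge0 k : 0 <= incr k by rewrite !addr_ge0 ?dotp_ge0.
have e0 : 0 < eps by case/andP: heps.
have dist_dec xs lams mus k : saddle_point X f A b g xs lams mus ->
    dist xs lams mus k.+1 <= dist xs lams mus k.
  move=> sp; apply: le_trans (fejer _ _ _ k sp).
  by rewrite lerDl mulr_ge0 ?(ltW e0).
have dist_comp xs lams mus k :
    [/\ forall i, dotp (x k.+1 i - xs i) (x k.+1 i - xs i) <= dist xs lams mus k,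
        dotp (lam k.+1 - lams) (lam k.+1 - lams) <= dist xs lams mus k
      & dotp (mu k.+1 - mus) (mu k.+1 - mus) <= dist xs lams mus k].
  have := sqdist_ge0 (x k.+1) xs; have := dotp_ge0 (lam k.+1 - lams).
  have := dotp_ge0 (mu k.+1 - mus); rewrite /dist /state_sqdist.
  by split=> [i||]; try (have := sqdist_ge (x k.+1) xs i); lra.
have incr_cvg0 : incr @ \oo --> 0.
  have := cvg_increments0 (fun k => dist_dec _ _ _ k sp0)
    (dist_ge0 xs0 lams0 mus0).
  move=> /(cvgMl_tmp (a := eps^-1)); rewrite mulr0 => hd.
  apply: (squeeze_cvgr _ (cvg_cst 0) hd); apply: filterE => k.
  rewrite incr_ge0 /= mulrC ler_pdivlMr// mulrC.
  by have := fejer _ _ _ k sp0; lra.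
have [U [UU subU]] := ultraFilterLemma (eventually_filter : ProperFilter \oo).
have PU : ProperFilter U := @ultra_proper _ _ UU.
have dist_le0 k : dist xs0 lams0 mus0 k <= dist xs0 lams0 mus0 0.
  by elim: k => // k; apply: le_trans; exact: dist_dec.
have hx i : exists l : 'cV[R]_(n i), (fun k => x k.+1 i) @ U --> l.
  apply: (ultra_cvg_sqbounded UU (a := xs0 i) (c := dist xs0 lams0 mus0 0)).
  apply: filterE => k; apply: le_trans (dist_le0 k).
  by have [] := dist_comp xs0 lams0 mus0 k.
have [lams lamU] : exists l : 'cV[R]_m, (fun k => lam k.+1) @ U --> l.
  apply: (ultra_cvg_sqbounded UU (a := lams0) (c := dist xs0 lams0 mus0 0)).
  apply: filterE => k; apply: le_trans (dist_le0 k).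
  by have [] := dist_comp xs0 lams0 mus0 k.
have [mus muU] : exists l : 'cV[R]_M, (fun k => mu k.+1) @ U --> l.
  apply: (ultra_cvg_sqbounded UU (a := mus0) (c := dist xs0 lams0 mus0 0)).
  apply: filterE => k; apply: le_trans (dist_le0 k).
  by have [] := dist_comp xs0 lams0 mus0 k.
pose xs i := projT1 (cid (hx i)).
have xU i : (fun k => x k.+1 i) @ U --> xs i by exact: projT2 (cid (hx i)).
have incrU : incr @ U --> 0 by apply: cvg_trans incr_cvg0; exact: cvg_app subU.
have incr_comp k :
    [/\ sqdist (x k.+2) (x k.+1) <= incr k,
        dotp ((p k.+1).1 - lam k.+1) ((p k.+1).1 - lam k.+1) <= incr k,
        dotp (lam k.+2 - (p k.+1).1) (lam k.+2 - (p k.+1).1) <= incr k,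
        dotp ((p k.+1).2 - mu k.+1) ((p k.+1).2 - mu k.+1) <= incr k
      & dotp (mu k.+2 - (p k.+1).2) (mu k.+2 - (p k.+1).2) <= incr k].
  have := sqdist_ge0 (x k.+2) (x k.+1).
  have := dotp_ge0 ((p k.+1).1 - lam k.+1).
  have := dotp_ge0 (lam k.+2 - (p k.+1).1).
  have := dotp_ge0 ((p k.+1).2 - mu k.+1).
  have := dotp_ge0 (mu k.+2 - (p k.+1).2).
  by rewrite /incr /pcpm_increment; split; lra.
have xU' i : (fun k => x k.+2 i) @ U --> xs i.
  apply: (cvg_of_sqdist_cvg (xU i) _ incrU) => k.
  by apply: le_trans (sqdist_ge _ _ _) _; have [] := incr_comp k.
have gamU : (fun k => (p k.+1).1) @ U --> lams.
  by apply: (cvg_of_sqdist_cvg lamU _ incrU) => k; have [] := incr_comp k.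
have lamU' : (fun k => lam k.+2) @ U --> lams.
  by apply: (cvg_of_sqdist_cvg gamU _ incrU) => k; have [] := incr_comp k.
have nuU : (fun k => (p k.+1).2) @ U --> mus.
  by apply: (cvg_of_sqdist_cvg muU _ incrU) => k; have [] := incr_comp k.
have muU' : (fun k => mu k.+2) @ U --> mus.
  by apply: (cvg_of_sqdist_cvg nuU _ incrU) => k; have [] := incr_comp k.
have sp : saddle_point X f A b g xs lams mus.
  exact: (saddle_point_of_limit hfcont hgcont hrho_gt0 hXclosed
    (fun k => hp k.+1) xU xU' lamU gamU lamU' muU nuU muU').
have dist0 : dist xs lams mus @ \oo --> 0.
  apply: (nonincreasing_cvg0_of_filter PU) => [k|k|].
  - exact: dist_dec.
  - exact: dist_ge0.
  - have cvg0 q (u : nat -> 'cV[R]_q) (a : 'cV[R]_q) : u @ U --> a ->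
        (fun k => dotp (u k - a) (u k - a)) @ U --> 0.
      move=> ua; rewrite -(dotp0r (a - a)) -[X in dotp _ X](subrr a).
      by apply: cvg_dotp; apply: cvg_cvB => //; exact: cvg_cst.
    rewrite -[X in _ --> X]addr0 -[X in _ --> X + _]addr0.
    apply: cvgD; last exact: cvg0.
    apply: cvgD; last exact: cvg0.
    rewrite (_ : 0 = \sum_(i < N) (0 : R)); last by rewrite big1.
    apply: (cvg_sum_fin
      (u := fun i k => dotp (x k.+1 i - xs i) (x k.+1 i - xs i))) => i.
    exact: cvg0.
exists xs, lams, mus; split=> // [i||].
- rewrite -(cvg_shiftS (fun k => x k i)); apply: (cvg_of_sqdist _ dist0).
  by apply: filterE => k; have [] := dist_comp xs lams mus k.
- rewrite -(cvg_shiftS lam); apply: (cvg_of_sqdist _ dist0).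
  by apply: filterE => k; have [] := dist_comp xs lams mus k.
- rewrite -(cvg_shiftS mu); apply: (cvg_of_sqdist _ dist0).
  by apply: filterE => k; have [] := dist_comp xs lams mus k.
Qed.
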